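(* For any $\varepsilon>0$, there exists $\kappa>0$ such that, for any $m\ge1$, $$\mathrm B^{\rm pol}_{\mathbb C,m}\le\kappa(1+\varepsilon)^m.$$
   Context: For $m\ge1$, $\mathrm B^{\rm pol}_{\mathbb C,m}$ is the best (smallest) constant $D_m\ge 1$ such that, for any $n\ge1$ and any $m$-homogeneous polynomial $P(z)=\sum_{|\alpha|=m}a_\alpha z^\alpha$ on $\mathbb C^n$, $$\Big(\sum_{|\alpha|=m}|a_\alpha|^{\frac{2m}{m+1}}\Big)^{\frac{m+1}{2m}}\le D_m\|P\|_\infty,\qquad \|P\|_\infty=\sup_{z\in\mathbb D^n}|P(z)|,$$ where $\mathbb D$ is the open unit disk of $\mathbb C$. Such a finite constant exists (the polynomial Bohnenblust--Hille inequality). *)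

(* Defs.v *)
From mathcomp Require Import all_boot all_order all_algebra.
From mathcomp Require Import complex.
From mathcomp Require Import all_classical all_reals all_analysis.
(* mpoly's notations have levels incompatible with those of mathcomp-analysis,
   so only its constants, coercions and canonical structures are imported. *)
From mathcomp Require Import -(notations) mpoly.

Set Implicit Arguments.
Unset Strict Implicit.
Unset Printing Implicit Defensive.

Import Order.TTheory GRing.Theory Num.Theory.
Local Open Scope classical_set_scope.
Local Open Scope ring_scope.
Local Open Scope complex_scope.

(* The norm of R[i] takes its values in R[i]; [normc] is the same modulus with
   values in R. *)
Notation normc := ComplexField.Normc.normc.

Definition polydisc (R : realType) (n : nat) : set ('I_n -> R[i]) :=
  [set z | forall j, normc (z j) < 1].

Lemma normc_meval_le (R : realType) (n : nat) (P : mpoly n R[i])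
    (z : 'I_n -> R[i]) :
  polydisc z -> normc (meval z P) <= \sum_(a <- msupp P) normc (mcoeff a P).
Proof.
move=> zD.
have zj j : `|z j| <= 1 :> R[i].
  by have := ltW (zD j); rewrite -lecR; case: (z j).
rewrite -lecR rmorph_sum /=.
have E (x : R[i]) : (normc x)%:C = `|x| by case: x.
rewrite E mevalE; under eq_bigr do rewrite E.
apply: le_trans (ler_norm_sum _ _ _) _; apply: ler_sum => a _.
rewrite normrM ler_piMr// normr_prod; apply: prodr_ile1 => j.
by rewrite normrX exprn_ge0//= exprn_ile1.
Qed.

Lemma has_sup_polydisc (R : realType) (n : nat) (P : mpoly n R[i]) :
  has_sup [set normc (meval z P) | z in @polydisc R n].
Proof.
split.
  exists (normc (meval (fun _ => 0) P)), (fun _ => 0) => // j /=.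
  by rewrite expr0n addr0 sqrtr0.
exists (\sum_(a <- msupp P) normc (mcoeff a P)) => _ [z zD <-].
exact: normc_meval_le.
Qed.

(* [sup] is 0 on unbounded sets; [has_sup_polydisc] excludes that case. *)
Definition sup_norm (R : realType) (n : nat) (P : mpoly n R[i]) : R :=
  sup [set normc (meval z P) | z in @polydisc R n].

Definition coef_norm (R : realType) (n m : nat) (p : R) (P : mpoly n R[i]) : R :=
  (\sum_(a : bmultinom n m.+1 | mdeg a == m) normc (mcoeff a P) `^ p) `^ p^-1.

Definition BH_pol_bound (R : realType) (m : nat) (D : R) : Prop :=
  forall n : nat, (0 < n)%N ->
  forall P : mpoly n R[i], P \is ishomog1 m mdeg ->
    coef_norm m ((2 * m)%:R / m.+1%:R) P <= D * sup_norm P.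

(* Taken in the extended reals: the infimum of the empty set is +oo, so that an
   upper bound on [BH_pol] also asserts that some constant is admissible. *)
Definition BH_pol (R : realType) (m : nat) : \bar R :=
  ereal_inf [set D%:E | D in [set D : R | 1 <= D /\ BH_pol_bound m D]].

(* Main.v *)
Require Import Defs.
From mathcomp Require Import all_boot all_order all_algebra.
From mathcomp Require Import cyclic separable cyclotomic complex.
From mathcomp Require Import all_classical all_reals all_analysis.
From mathcomp Require Import -(notations) mpoly.
From mathcomp Require Import ring lra.

(** Why the constants grow subexponentially.

    Write a multi-index [al] of degree [m = k_1 + ... + k_l] as a sum of
    multi-indices of degrees [k_1, ..., k_l], by any fixed rule.  Hoelder's
    inequality then bounds the l^(2m/(m+1)) norm of the coefficients [a al] of
    [P] by a geometric mean of mixed norms, one for each block: an l^2 norm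
    over all [al] whose [t]-th piece is [be], followed by an l^p norm over
    [be], where [p = 2k/(k+1)] and [k = k_t] ([block_interpolation]).

    Fix a block, of degree [k].  The inner l^2 norm is at most the L^2 norm on
    the torus of the Taylor coefficient [P_be] in
    [P(z + w) = sum_be P_be(z) w^be], because the coefficients of [P_be] are
    those of [P] multiplied by binomials.  As [P_be] is homogeneous of degree
    [m - k], its L^2 norm is at most [2^((m-k)/k)] times its L^p norm
    ([hypercontractive]): this follows by interpolating L^2 between L^p and
    L^4, since the L^4 and L^2 norms compare by counting the ways to write a
    multi-index as a sum of two ([norm4_le_norm2]).  Now exchange the sum over
    [be] and the average over [z].  For fixed [z], the Bohnenblust-Hille
    inequality in degree [k] applies to the polynomial
    [sum_be P_be(z) w^be] in [w], and Cauchy's estimate bounds that polynomial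
    by [dl^-k (1 + dl)^m] times the norm of [P], for any [dl > 0]
    ([taylor_part_bound]).

    Altogether, if [D] is admissible in degree [k] and [D dl^-k <= K] for
    every block, then [2^(l-1) K (1 + dl)^m] is admissible in degree [m]
    ([coef_BH_blocks]).  Blocks of degree 1 and [dl = 1] give the constant
    [4^m].  Feeding that back with blocks of degree at most a fixed [k], [K]
    does not depend on [m], and [2^(l-1) <= 2^(m/k)] is at most
    [(1 + dl)^m] once [2 <= (1 + dl)^k] ([coef_BH_subexponential]).

    Integrals over the torus are replaced throughout by averages over vectors
    of [N]-th roots of unity, which integrate exactly the trigonometric
    polynomials that occur as soon as [N] exceeds their degree. *)

Set Implicit Arguments.
Unset Strict Implicit.
Unset Printing Implicit Defensive.

Import Order.TTheory GRing.Theory Num.Theory ComplexField.Normc.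
Local Open Scope ring_scope.

(** * Inequalities for finite sums of real powers *)

Section PowerSums.
Variable R : realType.

(** Exponentiate the sum, with weights [th t], of
    [ln (a t / s) <= a t / s - 1], where [s] is the arithmetic mean: the
    right-hand sides add up to 0. *)
Lemma weighted_amgm (T : finType) (th a : T -> R) :
  (forall t, 0 < th t) -> \sum_t th t = 1 -> (forall t, 0 <= a t) ->
  \prod_t a t `^ th t <= \sum_t th t * a t.
Proof.
move=> th0 th1 a0.
have sge0 : 0 <= \sum_t th t * a t.
  by apply: sumr_ge0 => t _; rewrite mulr_ge0// ltW.
have [/existsP[t /eqP at0]|/existsPn aN0] := boolP [exists t, a t == 0].
  by rewrite (bigD1 t)//= at0 powR0 ?mul0r// gt_eqF.
have agt0 t : 0 < a t by rewrite lt_neqAle eq_sym aN0 a0.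
have sgt0 : 0 < \sum_t th t * a t.
  rewrite lt_neqAle sge0 andbT; apply/eqP => /esym/eqP.
  rewrite psumr_eq0 => [/allP s0|t _]; last by rewrite mulr_ge0// ltW.
  suff : (0 : R) = 1 by move/eqP; rewrite eq_sym oner_eq0.
  rewrite -th1 big1// => t _.
  have := s0 t (mem_index_enum t).
  by rewrite /= mulf_eq0 (negbTE (aN0 t)) orbF => /eqP.
set s := \sum_t _ in sgt0 *.
have -> : \prod_t a t `^ th t = expR (\sum_t th t * ln (a t)).
  rewrite expR_sum; apply: eq_bigr => t _.
  by rewrite /powR gt_eqF.
rewrite -[leRHS]lnK ?posrE// ler_expR -subr_ge0.
have -> : ln s - \sum_t th t * ln (a t) = \sum_t th t * - ln (a t / s).
  rewrite -[ln s]mul1r -th1 mulr_suml -sumrB; apply: eq_bigr => t _.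
  by rewrite ln_div ?posrE//; ring.
have : 0 = \sum_t th t * (1 - a t / s).
  under eq_bigr do rewrite mulrBr mulr1 mulrA.
  by rewrite sumrB th1 -mulr_suml divff ?subrr// gt_eqF.
move=> {1}->; apply: ler_sum => t _; rewrite ler_pM2l//.
have : 1 + ln (a t / s) <= a t / s.
  by rewrite -[leRHS]lnK ?posrE ?divr_gt0// expR_ge1Dx.
lra.
Qed.

(** After normalizing every [f t] to have sum 1, this is [weighted_amgm] summed
    over [x]. *)
Lemma holder_prod (X T : finType) (P : pred X) (th : T -> R) (f : T -> X -> R) :
  (forall t, 0 < th t) -> \sum_t th t = 1 -> (forall t x, 0 <= f t x) ->
  \sum_(x | P x) \prod_t f t x `^ th t <=
    \prod_t (\sum_(x | P x) f t x) `^ th t.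
Proof.
move=> th0 th1 f0.
pose S t := \sum_(x | P x) f t x.
have S0 t : 0 <= S t by apply: sumr_ge0.
have [/existsP[t /eqP St0]|/existsPn SN0] := boolP [exists t, S t == 0].
  rewrite big1; first by apply: prodr_ge0 => *; exact: powR_ge0.
  move=> x Px; rewrite (bigD1 t)//=.
  have /eqP := St0; rewrite psumr_eq0// => /allP/(_ x (mem_index_enum x)).
  by rewrite Px /= => /eqP ->; rewrite powR0 ?mul0r// gt_eqF.
have Sgt0 t : 0 < S t by rewrite lt_neqAle eq_sym SN0 S0.
rewrite -[leRHS]mul1r -ler_pdivrMr; last first.
  by apply: prodr_gt0 => t _; rewrite powR_gt0 ?Sgt0.
rewrite mulr_suml.
have S1 : \sum_(x | P x) \sum_t th t * (f t x / S t) = 1.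
  rewrite exchange_big -th1; apply: eq_bigr => t _ /=.
  by rewrite -mulr_sumr -mulr_suml divff ?mulr1 ?SN0.
rewrite -[leRHS]S1; apply: ler_sum => x _.
have := @weighted_amgm T th (fun t => f t x / S t) th0 th1.
move=> /(_ (fun t => divr_ge0 (f0 _ _) (S0 _))); apply: le_trans.
rewrite -prodf_div; apply: ler_prod => t _.
rewrite divr_ge0 ?powR_ge0//= powRM ?invr_ge0//.
by rewrite -[(S t)^-1]powR_inv1// -powRrM mulN1r powRN.
Qed.

Lemma big_option (S : Type) (idx : S) (op : Monoid.com_law idx)
    (T : finType) (F : option T -> S) :
  \big[op/idx]_o F o = op (F None) (\big[op/idx]_t F (Some t)).
Proof.
rewrite (bigD1 None)//=; congr (op _ _).
rewrite (reindex_omap Some id) => [|[t|]//].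
by apply: eq_bigl => t; rewrite /= eqxx.
Qed.

Lemma powR_prod (T : finType) (a : T -> R) (p : R) : (forall t, 0 <= a t) ->
  (\prod_t a t) `^ p = \prod_t a t `^ p.
Proof.
move=> a0.
suff /(_ (index_enum T)) [] : forall s, 0 <= \prod_(t <- s) a t /\
   (\prod_(t <- s) a t) `^ p = \prod_(t <- s) a t `^ p by [].
elim=> [|t s [s0 IH]]; first by rewrite !big_nil powR1.
by rewrite !big_cons mulr_ge0// powRM// IH.
Qed.

Lemma powR_sum (T : finType) (a : R) (p : T -> R) : 0 < a ->
  a `^ (\sum_t p t) = \prod_t a `^ p t.
Proof.
move=> a0; elim/big_ind2 : _ => [|x u y v <- <-|//]; first by rewrite powRr0.
by rewrite powRD ?lt0r_neq0 ?implybT.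
Qed.

(** Put [F t y] for the inner sum of squares and [w t y = F t y `^ (1/(k_t+1))].
    These weights make both the sum over [x] of [b x ^+ 2 / w t (pi t x)] and
    the sum over [y] of [w t y ^+ k t] equal to the outer sum [G t].  Since
    b^(2m/(m+1)) = prod_t (b^2 / w_t)^(k_t/(m+1)) * (prod_t w_t^k_t)^(1/(m+1)),
    Hoelder's inequality reduces the claim to bounding the sum over [x] of
    [prod_t w_t^k_t] by [prod_t G t], which holds because [x] is determined by
    its images [pi t x]. *)
Lemma block_interpolation (X T Y : finType) (P : pred X) (pi : T -> X -> Y)
    (k : T -> nat) (b : X -> R) (m := (\sum_t k t)%N) :
  (0 < m)%N -> (forall t, (0 < k t)%N) ->
  (forall x y, P x -> P y -> (forall t, pi t x = pi t y) -> x = y) ->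
  (forall x, 0 <= b x) ->
  \sum_(x | P x) b x `^ ((2 * m)%:R / m.+1%:R) <=
  \prod_t (\sum_y (\sum_(x | P x && (pi t x == y)) b x ^+ 2)
              `^ ((k t)%:R / (k t).+1%:R)) `^ ((k t).+1%:R / m.+1%:R).
Proof.
move=> m0 k0 pi_inj b0.
pose F t y := \sum_(x | P x && (pi t x == y)) b x ^+ 2.
pose w t y := F t y `^ ((k t).+1%:R^-1).
pose G t := \sum_y F t y `^ ((k t)%:R / (k t).+1%:R).
have F0 t y : 0 <= F t y by apply: sumr_ge0 => x _; exact: sqr_ge0.
have w0 t y : 0 <= w t y by exact: powR_ge0.
have G0 t : 0 <= G t by apply: sumr_ge0 => y _; exact: powR_ge0.
have mp : (0 : R) < m.+1%:R by rewrite ltr0n.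
have kp t : (0 : R) < (k t).+1%:R by rewrite ltr0n.
have wk t y : w t y ^+ k t = F t y `^ ((k t)%:R / (k t).+1%:R).
  by rewrite -powR_mulrn// -powRrM mulrC.
have sumbw t : \sum_(x | P x) b x ^+ 2 / w t (pi t x) = G t.
  rewrite (partition_big (pi t) xpredT)//=; apply: eq_bigr => y _.
  rewrite (eq_bigr (fun x => b x ^+ 2 / w t y)); last first.
    by move=> x /andP[_ /eqP ->].
  rewrite -mulr_suml -/(F t y) -(powR_inv1 (w0 _ _)) -powRrM mulrN1.
  have [->|FN0] := eqVneq (F t y) 0.
    by rewrite mul0r powR0// mulf_neq0 ?invr_neq0 ?pnatr_eq0 -?lt0n.
  rewrite -{1}(powRr1 (F0 t y)) -powRD ?FN0 ?implybT//.
  congr (_ `^ _); have := lt0r_neq0 (kp t).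
  by rewrite -natr1 => ?; field.
have sumw : \sum_(x | P x) \prod_t w t (pi t x) ^+ k t <= \prod_t G t.
  under [leRHS]eq_bigr do rewrite /G.
  under [leRHS]eq_bigr do under eq_bigr do rewrite -wk.
  rewrite bigA_distr_bigA /=.
  pose h x := [ffun t => pi t x].
  rewrite (eq_bigr (fun x => \prod_t w t (h x t) ^+ k t)); last first.
    by move=> x _; apply: eq_bigr => t _; rewrite ffunE.
  (* The expanded product of the [G t] ranges over all functions from [T] to
     [Y]; by injectivity, those of the form [h x] are enough. *)
  rewrite -(big_imset (fun f : {ffun T -> Y} => \prod_t w t (f t) ^+ k t)) /=.
    rewrite [leRHS](bigID (mem (h @: P))) /= lerDl.
    by apply: sumr_ge0 => f _; apply: prodr_ge0 => t _; rewrite exprn_ge0.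
  move=> x y Px Py /ffunP hxy; apply: pi_inj => // t.
  by have := hxy t; rewrite !ffunE.
(* [None] indexes the additional factor [prod_t w_t^k_t]. *)
pose f (o : option T) x := if o is Some t then b x ^+ 2 / w t (pi t x)
  else \prod_t w t (pi t x) ^+ k t.
pose th (o : option T) : R := if o is Some t then (k t)%:R / m.+1%:R
  else m.+1%:R^-1.
have th0 o : 0 < th o.
  by case: o => [t|]; rewrite /th ?divr_gt0 ?invr_gt0 ?ltr0n.
have th1 : \sum_o th o = 1.
  rewrite big_option /= -mulr_suml -natr_sum -/m -{1}[m.+1%:R^-1]mul1r.
  by rewrite -mulrDl addrC natr1 divff ?lt0r_neq0.
have f0 o x : 0 <= f o x.
  case: o => [t|]; rewrite /f ?divr_ge0 ?sqr_ge0//.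
  by apply: prodr_ge0 => t _; rewrite exprn_ge0.
have := holder_prod P th0 th1 f0.
rewrite [X in _ <= X -> _]big_option /=.
under [X in _ <= _ * X -> _]eq_bigr do rewrite sumbw.
move=> H; apply: le_trans (le_trans H _); last first.
  apply: le_trans (_ : (\prod_t G t) `^ m.+1%:R^-1 *
     \prod_t G t `^ ((k t)%:R / m.+1%:R) <= _).
    rewrite ler_wpM2r//; first by apply: prodr_ge0 => *; exact: powR_ge0.
    rewrite ge0_ler_powR ?nnegrE ?invr_ge0//.
      by apply: sumr_ge0 => x _; exact: (f0 None).
    by apply: prodr_ge0 => *; exact: G0.
  rewrite powR_prod// -big_split /=; apply: ler_prod => t _.
  rewrite mulr_ge0 ?powR_ge0//= -powRD; last first.
    by rewrite gt_eqF//= addr_gt0 ?invr_gt0 ?divr_gt0 ?ltr0n.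
  by rewrite -{1}[m.+1%:R^-1]mul1r -mulrDl addrC natr1.
apply: ler_sum => x Px; rewrite big_option /=.
have [bx0|bxN0] := eqVneq (b x) 0.
  rewrite bx0 powR0 ?mulf_neq0 ?invr_neq0 ?pnatr_eq0 ?muln_eq0//= -?lt0n//.
  by rewrite mulr_ge0 ?powR_ge0//; apply: prodr_ge0 => *; exact: powR_ge0.
have wgt0 t : 0 < w t (pi t x).
  rewrite powR_gt0// (lt_le_trans (_ : 0 < b x ^+ 2)) ?exprn_gt0//.
    by rewrite lt_neqAle eq_sym bxN0 b0.
  rewrite /F (bigD1 x) ?Px ?eqxx//= lerDl.
  by apply: sumr_ge0 => y _; exact: sqr_ge0.
rewrite powR_prod; last by move=> t; rewrite exprn_ge0.
rewrite -big_split /=.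
rewrite (eq_bigr (fun t => b x `^ ((2 * k t)%:R / m.+1%:R))); last first.
  move=> t _; rewrite -powR_mulrn// -powRrM -(powR_mulrn 2 (b0 x)).
  rewrite powRM ?powR_ge0 ?invr_ge0// -powRrM.
  rewrite -(powR_inv1 (w0 _ _)) -powRrM mulrCA -powRD ?lt0r_neq0 ?implybT//.
  by rewrite mulN1r subrr powRr0 mulr1 natrM mulrA.
rewrite -powR_sum; last by rewrite lt_neqAle eq_sym bxN0 b0.
by rewrite -mulr_suml -natr_sum -big_distrr.
Qed.

Lemma bernoulli_inequality (x : R) k : -1 <= x -> 1 + k%:R * x <= (1 + x) ^+ k.
Proof.
move=> x1; elim: k => [|k IH]; first by rewrite mul0r addr0 expr0.
rewrite exprS; apply: (@le_trans _ _ ((1 + x) * (1 + k%:R * x))).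
  rewrite -natr1; have : 0 <= k%:R * x ^+ 2 by rewrite mulr_ge0 ?sqr_ge0.
  by rewrite expr2; lra.
by rewrite ler_wpM2l//; lra.
Qed.

End PowerSums.

(** * Homogeneous polynomials averaged over roots of unity *)

Section RootAverages.
Variable R : realType.
Local Notation C := R[i].
Implicit Types n m d k N : nat.

Lemma normcC (x : C) : ((normc x)%:C)%C = `|x|.
Proof. by case: x. Qed.

Lemma normcX (x : C) j : normc (x ^+ j) = normc x ^+ j.
Proof.
by elim: j => [|j IH]; [rewrite !expr0 normc1|rewrite !exprS normcM IH].
Qed.

Lemma normc_ge0 (x : C) : 0 <= normc x.
Proof. by case: x => x y; exact: sqrtr_ge0. Qed.

Lemma normc_sum (I : Type) (r : seq I) (P : pred I) (F : I -> C) :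
  normc (\sum_(i <- r | P i) F i) <= \sum_(i <- r | P i) normc (F i).
Proof.
elim/big_ind2 : _ => [|x u y v xu yv|//]; first by rewrite normc0.
by apply: le_trans (le_normcD _ _) _; rewrite lerD.
Qed.

Lemma normc_real (x : R) : 0 <= x -> normc ((x%:C)%C) = x.
Proof. by move=> x0; rewrite /= expr0n addr0 sqrtr_sqr ger0_norm. Qed.

Lemma normc_nat j : normc (j%:R : C) = j%:R.
Proof. by rewrite -(rmorph_nat (real_complex R)) normc_real. Qed.

Lemma normc_conj (x : C) : normc (conjc x) = normc x.
Proof.
by apply: (@fmorph_inj _ _ (real_complex R)); rewrite /= !normcC normcJ.
Qed.

Lemma sqr_normcC (x : C) : ((normc x ^+ 2)%:C)%C = x * conjc x.
Proof. by rewrite rmorphXn /= normcC sqr_normc. Qed.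

Lemma prim_root_exists N : (0 < N)%N -> exists w : C, N.-primitive_root w.
Proof.
pose p : {poly C} := 'X^N - 1; have [r Dp] := closed_field_poly_normal p.
move=> N0; rewrite (monicP _) ?monicXnsubC // scale1r in Dp.
have rn1: all N.-unity_root r by apply/allP=> z; rewrite -root_prod_XsubC -Dp.
have sz_r: (N < (size r).+1)%N.
  by rewrite -(size_prod_XsubC r id) -Dp size_XnsubC.
have [|z] := hasP (has_prim_root N0 rn1 _ sz_r); last by exists z.
by rewrite -separable_prod_XsubC -Dp separable_Xn_sub_1 // pnatr_eq0 -lt0n.
Qed.

Lemma normc_root N (w : C) : (0 < N)%N -> w ^+ N = 1 -> normc w = 1.
Proof.
move=> N0 wN; apply/eqP.
by rewrite -(@pexpr_eq1 _ (normc w) N)// ?normc_ge0// -normcX wN normc1.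
Qed.

(** The orthogonality of the characters of the group of [N]-th roots of unity,
    obtained from the geometric sum of [w^(i-j)]. *)
Lemma sum_root_powers N (w : C) i j :
  N.-primitive_root w -> (i < N)%N -> (j < N)%N ->
  \sum_(s < N) (w ^+ i * conjc w ^+ j) ^+ s = (N * (i == j))%:R.
Proof.
move=> wN iN jN; have N0 : (0 < N)%N by apply: leq_ltn_trans iN.
have w1 : normc w = 1 by apply: normc_root N0 (prim_expr_order wN).
have ww : w * conjc w = 1 by rewrite -sqr_normcC w1 expr1n.
have [->|ij] := eqVneq i j.
  rewrite -exprMn ww muln1; under eq_bigr do rewrite !expr1n.
  by rewrite sumr_const card_ord.
rewrite muln0; set u := _ * _.
have uN : u ^+ N = 1.
  rewrite exprMn -!exprM ![(_ * N)%N]mulnC !exprM (prim_expr_order wN) expr1n.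
  by rewrite mul1r -rmorphXn /= (prim_expr_order wN) rmorph1 expr1n.
have : (u - 1) * \sum_(s < N) u ^+ s = 0 by rewrite -subrX1 uN subrr.
move/eqP; rewrite mulf_eq0 => /orP[|/eqP //].
rewrite subr_eq0 => /eqP u1; case/negP: ij.
have : w ^+ i == w ^+ j.
  by rewrite -[X in _ == X]mul1r -u1 /u -mulrA -exprMn mulrC [_ * w]mulrC ww
     expr1n mul1r.
by rewrite (eq_prim_root_expr wN) !modn_small.
Qed.

Definition mono n (z : 'I_n -> C) (a : multinom n) : C := \prod_j z j ^+ a j.

Lemma mono_add n (z : 'I_n -> C) (a b : multinom n) :
  mono z (mnm_add a b) = mono z a * mono z b.
Proof.
by rewrite /mono -big_split; apply: eq_bigr => j _; rewrite mnmDE exprD.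
Qed.

Lemma mono_scale n (l : C) (z : 'I_n -> C) (a : multinom n) :
  mono (fun j => l * z j) a = l ^+ mdeg a * mono z a.
Proof.
rewrite /mono mdegE expr_sum -big_split; apply: eq_bigr => j _.
by rewrite exprMn.
Qed.

(** The coefficients form a function on all multi-indices, of which only the
    values in degree [d] matter.  The bound [b > d] makes the index type finite;
    leaving it free lets polynomials of different degrees share one index
    type. *)
Definition hpoly n b d (a : multinom n -> C) (z : 'I_n -> C) : C :=
  \sum_(al : bmultinom n b | mdeg al == d) a al * mono z al.

Lemma hpoly_scale n b m (a : multinom n -> C) (l : C) z :
  hpoly b m a (fun j => l * z j) = l ^+ m * hpoly b m a z.
Proof.
rewrite /hpoly mulr_sumr; apply: eq_bigr => al /eqP alm.
by rewrite mono_scale alm mulrCA.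
Qed.

Lemma hpoly_bound_ge0 n b m (a : multinom n -> C) (M : R) :
  (forall z, (forall j, normc (z j) <= 1) -> normc (hpoly b m a z) <= M) ->
  0 <= M.
Proof.
move=> aM; apply: le_trans (normc_ge0 _) (aM (fun _ => 0) _) => j.
by rewrite normc0.
Qed.

Lemma mnm_le_mdeg n (a : multinom n) j : (a j <= mdeg a)%N.
Proof. by rewrite mdegE (bigD1 j)//= leq_addr. Qed.

Definition root_point n N (w : C) (t : {ffun 'I_n -> 'I_N}) (j : 'I_n) : C :=
  w ^+ t j.

Lemma mono_orth n N (w : C) (a b : multinom n) : N.-primitive_root w ->
  (mdeg a < N)%N -> (mdeg b < N)%N ->
  \sum_(t : {ffun 'I_n -> 'I_N})
     mono (root_point w t) a * conjc (mono (root_point w t) b)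
  = (N ^ n * (a == b))%:R.
Proof.
move=> wN aN bN.
have ajN j : (a j < N)%N := leq_ltn_trans (mnm_le_mdeg _ _) aN.
have bjN j : (b j < N)%N := leq_ltn_trans (mnm_le_mdeg _ _) bN.
transitivity (\sum_(t : {ffun 'I_n -> 'I_N})
    \prod_j (w ^+ a j * conjc w ^+ b j) ^+ t j).
  apply: eq_bigr => t _; rewrite /mono rmorph_prod -big_split.
  apply: eq_bigr => j _; rewrite /root_point !rmorphXn /= exprMn -!exprM.
  by congr (_ ^+ _ * _ ^+ _); rewrite mulnC.
rewrite -(bigA_distr_bigA
  (fun j (s : 'I_N) => (w ^+ a j * conjc w ^+ b j) ^+ s)).
under eq_bigr do rewrite sum_root_powers//.
rewrite -natr_prod; congr _%:R; rewrite big_split prod_nat_const card_ord /=.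
congr muln; have [->|ab] := eqVneq a b.
  by rewrite big1// => j; rewrite eqxx.
suff [j abj] : exists j, a j != b j.
  by rewrite (bigD1 j)//= (negbTE abj).
apply/existsP; rewrite -negb_forall; apply: contra ab => /forallP ab.
by apply/eqP/mnmP => j; apply/eqP.
Qed.

Lemma parseval n b N (w : C) (P : pred (bmultinom n b)) (c : multinom n -> C) :
  N.-primitive_root w -> (b <= N)%N ->
  \sum_(t : {ffun 'I_n -> 'I_N})
     normc (\sum_(a | P a) c a * mono (root_point w t) a) ^+ 2 =
  (N ^ n)%:R * \sum_(a | P a) normc (c a) ^+ 2.
Proof.
move=> wN bN; apply: (@fmorph_inj _ _ (real_complex R)).
rewrite rmorphM !rmorph_sum rmorph_nat /=.
under eq_bigr do rewrite sqr_normcC rmorph_sum /= big_distrlr /=.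
rewrite exchange_big mulr_sumr; apply: eq_bigr => a Pa /=.
rewrite exchange_big /= (bigD1 a)//= [X in _ + X]big1 ?addr0; last first.
  move=> a' /andP[Pa' aa']; under eq_bigr do rewrite rmorphM mulrACA.
  rewrite -mulr_sumr mono_orth// ?(leq_trans (bmdeg _) bN)//.
  by rewrite -bmeqP eq_sym (negbTE aa') muln0 mulr0.
under eq_bigr do rewrite rmorphM mulrACA.
rewrite -mulr_sumr mono_orth// ?(leq_trans (bmdeg _) bN)//.
by rewrite eqxx muln1 sqr_normcC mulrC.
Qed.

Lemma sqr_sum_le (I : finType) (P : pred I) (f : I -> R) :
  (\sum_(i | P i) f i) ^+ 2 <= #|P|%:R * \sum_(i | P i) f i ^+ 2.
Proof.
have [P0|P0] := posnP #|P|.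
  rewrite P0 mul0r big1 ?expr0n// => i Pi.
  by move/eqP: P0 => /pred0P /(_ i); rewrite Pi.
set S := \sum_(i | P i) f i; set q : R := #|P|%:R.
have q0 : 0 < q by rewrite ltr0n.
have : 0 <= \sum_(i | P i) (q * f i - S) ^+ 2.
  by apply: sumr_ge0 => i _; exact: sqr_ge0.
have -> : \sum_(i | P i) (q * f i - S) ^+ 2 =
  q * (q * (\sum_(i | P i) f i ^+ 2) - S ^+ 2).
  rewrite (eq_bigr (fun i =>
      q ^+ 2 * f i ^+ 2 + (- (q * S) *+ 2) * f i + S ^+ 2)).
    rewrite !big_split -!mulr_sumr -/S sumr_const -/q.
    by rewrite -(mulr_natl S) -/q /=; ring.
  by move=> i _; ring.
by rewrite pmulr_rge0// subr_ge0.
Qed.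

(** There are [g j + 1 <= 2 ^ g j] choices for each entry. *)
Lemma card_mnm_le n b (g : multinom n) :
  (#|[pred a : bmultinom n b | [forall j, a j <= g j]]| <= 2 ^ mdeg g)%N.
Proof.
pose h (a : bmultinom n b) := [ffun j => inord (a j) : 'I_(mdeg g).+1].
pose F (j : 'I_n) := [pred i : 'I_(mdeg g).+1 | i <= g j]%N.
set A := [pred a | _].
have hE a j : a \in A -> h a j = a j :> nat.
  move=> /forallP/(_ j) ag; rewrite ffunE inordK// ltnS.
  by apply: leq_trans ag (mnm_le_mdeg _ _).
have hinj : {in A &, injective h}.
  move=> a a' aA a'A haa'; apply/val_inj/mnmP => j.
  by rewrite -!hE// haa'.
rewrite -(card_in_image hinj); apply: (@leq_trans #|family F|).
  apply/subset_leq_card/fintype.subsetP => _ /fintype.imageP[a aA ->].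
  apply/familyP => j; rewrite inE hE//; by move/forallP: aA.
rewrite card_family foldrE big_image /=.
have -> : (2 ^ mdeg g = \prod_j 2 ^ g j)%N by rewrite mdegE expn_sum.
apply: leq_prod => j _; apply: (@leq_trans (g j).+1); last exact: ltn_expl.
pose u (i : 'I_(mdeg g).+1) : 'I_(g j).+1 := inord i.
have uinj : {in F j &, injective u}.
  move=> i i'; rewrite !inE => ij i'j /(congr1 val).
  by rewrite /= !inordK// => /val_inj.
rewrite -[leqRHS]card_ord.
apply: leq_trans (max_card (mem [seq u x | x in F j])).
by rewrite card_in_image.
Qed.

Lemma mnm_addb_subproof n b (x y : bmultinom n b) :
  (mdeg (mnm_add x y) < b + b)%N.
Proof. by rewrite mdegD -addnS leq_add ?(ltnW (bmdeg x)) ?bmdeg. Qed.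

Definition mnm_addb n b (x y : bmultinom n b) : bmultinom n (b + b) :=
  BMultinom (mnm_addb_subproof x y).

(** The square of the polynomial is homogeneous of degree [2 d], and its
    coefficient at [a] is a sum over the at most [2 ^ (2 d)] ways to write [a]
    as a sum of two multi-indices.  Apply [parseval] to the square and
    Cauchy-Schwarz to each coefficient. *)
Lemma norm4_le_norm2 n d b N (w : C) (c : multinom n -> C) :
  N.-primitive_root w -> (b + b <= N)%N ->
  \sum_(t : {ffun 'I_n -> 'I_N}) normc (hpoly b d c (root_point w t)) ^+ 4
  <= (N ^ n)%:R * (4 ^+ d *
      (\sum_(a : bmultinom n b | mdeg a == d) normc (c a) ^+ 2) ^+ 2).
Proof.
move=> wN bN.
pose P (p : bmultinom n b * bmultinom n b) :=
  (mdeg p.1 == d) && (mdeg p.2 == d).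
pose g (p : bmultinom n b * bmultinom n b) := mnm_addb p.1 p.2.
pose c2 (a : multinom n) := \sum_(p | P p && (bmnm (g p) == a)) c p.1 * c p.2.
rewrite (eq_bigr (fun t => normc (\sum_(a : bmultinom n (b + b))
   c2 a * mono (root_point w t) a) ^+ 2)); last first.
  move=> t _; rewrite /hpoly (exprM _ 2 2) -normcX; congr (normc _ ^+ 2).
  rewrite expr2 big_distrlr /= pair_big /=.
  rewrite (partition_big g xpredT)//=; apply: eq_bigr => a _.
  rewrite mulr_suml; apply: eq_big => [//|p /andP[_ /eqP <-]].
  by rewrite /g /= mono_add; ring.
rewrite parseval// ler_wpM2l//.
rewrite [_ ^+ 2]expr2 [X in _ <= _ * X]big_distrlr /= pair_big /=.
rewrite [X in _ <= _ * X](partition_big g xpredT)//= mulr_sumr.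
apply: ler_sum => a _.
have le1 : normc (c2 a) ^+ 2 <=
    (\sum_(p : bmultinom n b * bmultinom n b | P p && (g p == a))
       normc (c p.1 * c p.2)) ^+ 2.
  rewrite ler_sqr ?nnegrE ?normc_ge0//; first exact: normc_sum.
  by apply: sumr_ge0 => *; exact: normc_ge0.
apply: le_trans le1 (le_trans (sqr_sum_le _ _) _).
rewrite (eq_bigr (fun p : bmultinom n b * bmultinom n b =>
  normc (c p.1) ^+ 2 * normc (c p.2) ^+ 2)); last first.
  by move=> p _; rewrite normcM exprMn.
have S0 : 0 <= \sum_(p : bmultinom n b * bmultinom n b | P p && (g p == a))
      normc (c p.1) ^+ 2 * normc (c p.2) ^+ 2.
  by apply: sumr_ge0 => p _; rewrite mulr_ge0 ?sqr_ge0.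
have [ad|ad] := eqVneq (mdeg a) (2 * d)%N; last first.
  rewrite !big_pred0 ?mulr0// => p.
  apply/negP => /andP[/andP[/eqP p1 /eqP p2] /eqP ga].
  by move: ad; rewrite -ga /= mdegD p1 p2 addnn mul2n eqxx.
rewrite ler_wpM2r// -natrX ler_nat (_ : 4 ^ d = 2 ^ mdeg a)%N; last first.
  by rewrite ad expnM.
apply: leq_trans (card_mnm_le b a).
rewrite -(@card_in_image _ _ fst).
  apply/subset_leq_card/fintype.subsetP => y /fintype.imageP[p].
  move=> /andP[_ /eqP <-] ->.
  by apply/forallP => j; rewrite /g /= mnmDE leq_addr.
move=> [x y] [x' y'] /andP[_ /eqP <-].
move=> /andP[_ /eqP /(congr1 (@bmnm _ _))] /= e xx'.
subst x'; congr pair; apply/val_inj.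
by have /(congr1 (fun u => mnm_sub u x)) := e; rewrite !(addmC x) !addmK.
Qed.

(** Since [2 = p (k+1)/(k+2) + 4/(k+2)] for [p = 2k/(k+1)], Hoelder's inequality
    bounds the mean of [|Q|^2] by a product of powers of the means of [|Q|^p]
    and [|Q|^4].  By [norm4_le_norm2] the mean of [|Q|^4] is at most [4 ^ d]
    times the square of the mean of [|Q|^2]; gather the powers of the latter on
    the left. *)
Lemma hypercontractive n d b N k (w : C) (c : multinom n -> C) :
  (0 < k)%N -> N.-primitive_root w -> (b + b <= N)%N -> (0 < N)%N ->
  (\sum_(a : bmultinom n b | mdeg a == d) normc (c a) ^+ 2)
    `^ (k%:R / k.+1%:R)
  <= 4 `^ (d%:R / k.+1%:R) * ((N ^ n)%:R^-1 *
   \sum_(t : {ffun 'I_n -> 'I_N}) normc (hpoly b d c (root_point w t))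
     `^ ((2 * k)%:R / k.+1%:R)).
Proof.
move=> k0 wN bN N0.
pose Q (t : {ffun 'I_n -> 'I_N}) := normc (hpoly b d c (root_point w t)).
set S := \sum_(a | _) _.
set V : R := (N ^ n)%:R.
have V0 : 0 < V by rewrite ltr0n expn_gt0 N0.
have Q0 t : 0 <= Q t by exact: normc_ge0.
set p : R := (2 * k)%:R / k.+1%:R.
have k1 : (0 : R) < k.+1%:R by rewrite ltr0n.
have k2 : (0 : R) < k.+2%:R by rewrite ltr0n.
have S0 : 0 <= S by apply: sumr_ge0 => a _; exact: sqr_ge0.
set Ap := V^-1 * _.
have Ap0 : 0 <= Ap.
  rewrite mulr_ge0 ?invr_ge0 ?(ltW V0)//.
  by apply: sumr_ge0 => t _; exact: powR_ge0.
have [->|SN0] := eqVneq S 0.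
  rewrite powR0; first by rewrite mulr_ge0 ?powR_ge0.
  by rewrite mulf_neq0 ?invr_neq0 ?pnatr_eq0 -?lt0n.
have Sgt0 : 0 < S by rewrite lt_neqAle eq_sym SN0.
pose th (o : bool) : R := if o then k.+1%:R / k.+2%:R else k.+2%:R^-1.
pose f (o : bool) t := if o then Q t `^ p else Q t ^+ 4.
have th0 o : 0 < th o by case: o; rewrite /th ?divr_gt0 ?invr_gt0.
have th1 : \sum_o th o = 1.
  by rewrite big_bool /= -[X in _ + X]mul1r -mulrDl natr1 divff ?lt0r_neq0.
have f0 o t : 0 <= f o t by case: o; rewrite /f ?powR_ge0 ?exprn_ge0.
have := holder_prod xpredT th0 th1 f0; rewrite [X in _ <= X]big_bool /=.
rewrite [X in X <= _](eq_bigr (fun t => Q t ^+ 2)); last first.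
  move=> t _; rewrite big_bool /= -(powR_mulrn 4 (Q0 t)) -!powRrM.
  rewrite -powRD; last first.
    by rewrite gt_eqF//= addr_gt0// ?mulr_gt0 ?invr_gt0 ?divr_gt0 ?ltr0n
      ?muln_gt0.
  rewrite -(powR_mulrn 2 (Q0 t)); congr (_ `^ _).
  move: (lt0r_neq0 k1) (lt0r_neq0 k2); rewrite /p natrM -!natr1 => *; field.
  by apply/andP.
rewrite parseval//; last by apply: leq_trans bN; exact: leq_addr.
rewrite -/S -/V.
have -> : \sum_t Q t `^ p = V * Ap by rewrite /Ap mulrA divff ?mul1r ?lt0r_neq0.
move: Ap Ap0 => Ap Ap0 H.
have {}H : V * S <= (V * Ap) `^ th true * (V * (4 ^+ d * S ^+ 2)) `^ th false.
  apply: le_trans H _; rewrite ler_wpM2l ?powR_ge0//.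
  rewrite ge0_ler_powR ?nnegrE ?(ltW (th0 false))//.
  - by apply: sumr_ge0 => t _; exact: exprn_ge0.
  - by rewrite !mulr_ge0 ?exprn_ge0// ?ltW.
  - exact: norm4_le_norm2.
have {}H : S <= Ap `^ th true * (4 ^+ d * S ^+ 2) `^ th false.
  rewrite -(ler_pM2l V0); apply: le_trans H _.
  have V0' := ltW V0.
  have : 0 <= 4 ^+ d * S ^+ 2 by rewrite mulr_ge0 ?exprn_ge0.
  move: (4 ^+ d * S ^+ 2) => E E0; rewrite (powRM _ V0' Ap0) (powRM _ V0' E0).
  rewrite mulrACA -powRD; last by rewrite gt_eqF//= addr_gt0.
  have -> : th true + th false = 1 by rewrite -th1 big_bool.
  by rewrite powRr1.
have k21 : 0 < k.+2%:R / k.+1%:R :> R by rewrite divr_gt0.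
have : S `^ (k.+2%:R / k.+1%:R) <=
  (Ap `^ th true * (4 ^+ d * S ^+ 2) `^ th false) `^ (k.+2%:R / k.+1%:R).
  by rewrite ge0_ler_powR ?nnegrE ?(ltW k21)// mulr_ge0 ?powR_ge0.
rewrite powRM ?powR_ge0// -!powRrM.
have -> : th true * (k.+2%:R / k.+1%:R) = 1.
  by rewrite /th /=; field; rewrite !lt0r_neq0.
have -> : th false * (k.+2%:R / k.+1%:R) = k.+1%:R^-1.
  by rewrite /th /=; field; rewrite !lt0r_neq0.
rewrite powRr1// powRM ?exprn_ge0// -(powR_mulrn d) -?(powR_mulrn 2 S0)//.
rewrite -!powRrM.
move=> {}H.
have S2 : 0 < S `^ (2%:R / k.+1%:R) by exact: powR_gt0.
rewrite -(ler_pM2r S2) -powRD ?SN0 ?implybT//.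
rewrite -mulrDl -natrD addn2 [X in _ <= X]mulrAC; apply: le_trans H _.
by rewrite mulrC.
Qed.

End RootAverages.

(** * Taylor expansion in two vector variables *)

Section Taylor.
Variable R : realType.
Local Notation C := R[i].
Implicit Types n m d k N : nat.

Definition mnm_bin n (a g : multinom n) : nat := \prod_j 'C(a j, g j).

(** Expand each factor by the binomial formula and distribute the product.  The
    indices of the resulting sum are the vectors with entries below [b], of
    which only those below [a] contribute. *)
Lemma mono_binomial n b (x y : 'I_n -> C) (a : multinom n) : (mdeg a < b)%N ->
  mono (fun j => x j + y j) a =
  \sum_(g : bmultinom n b | lem g a)
     (mnm_bin a g)%:R * mono x (mnm_sub a g) * mono y g.
Proof.
move=> ab; have ajb j : (a j < b)%N := leq_ltn_trans (mnm_le_mdeg _ _) ab.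
pose G j i : C := 'C(a j, i)%:R * x j ^+ (a j - i) * y j ^+ i.
have -> : mono (fun j => x j + y j) a = \prod_j \sum_(i < b) G j i.
  apply: eq_bigr => j _; rewrite exprDn.
  rewrite (big_ord_widen _
    (fun i => x j ^+ (a j - i) * y j ^+ i *+ 'C(a j, i)) (ajb j)).
  rewrite big_mkcond; apply: eq_bigr => i _; rewrite /G -mulrA mulr_natl.
  by case: ltnP => // ai; rewrite bin_small.
rewrite bigA_distr_bigA /=.
pose h (g : bmultinom n b) : {ffun 'I_n -> 'I_b} :=
  [ffun j => Ordinal (leq_ltn_trans (mnm_le_mdeg g j) (bmdeg g))].
pose h' (f : {ffun 'I_n -> 'I_b}) : option (bmultinom n b) :=
  insub (Multinom [tuple (f j : nat) | j < n]).
rewrite (bigID (fun f : {ffun 'I_n -> 'I_b} => [forall j, f j <= a j]%N)) /=.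
rewrite [X in _ + X]big1 ?addr0; last first.
  move=> f /forallPn[j]; rewrite -ltnNge => aj.
  by rewrite (bigD1 j)//= /G bin_small// !mul0r.
rewrite (reindex_omap h h') /=; last first.
  move=> f /forallP fa; rewrite /h'; case: insubP => [g _ gE|]/=.
    congr Some; apply/ffunP => j; rewrite ffunE; apply/val_inj => /=.
    by rewrite gE mnmE.
  rewrite -leqNgt => /(leq_trans ab); rewrite ltnNge => /negP[].
  by rewrite !mdegE; apply: leq_sum => j _; rewrite mnmE.
apply: eq_big => [g|g _].
  have -> : h' (h g) = Some g.
    rewrite /h' (_ : Multinom _ = g) ?valK//.
    by apply/mnmP => j; rewrite mnmE ffunE.
  by rewrite eqxx andbT; apply/forallP/mnm_lepP => + j => /(_ j); rewrite ffunE.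
rewrite /mono /mnm_bin natr_prod -!big_split; apply: eq_bigr => j _.
by rewrite /G !ffunE mnmBE.
Qed.

Lemma sum_mnm_above (V : nmodType) n m k b (be : bmultinom n b)
    (F : multinom n -> V) :
  mdeg be = k -> (k <= m)%N -> (m < b)%N ->
  \sum_(a : bmultinom n b | (mdeg a == m) && lem be a) F a =
  \sum_(g : bmultinom n b | mdeg g == (m - k)%N) F (mnm_add be g).
Proof.
move=> bek km mb.
pose h (a : bmultinom n b) : bmultinom n b :=
  BMultinom (leq_ltn_trans (mdegB a be) (bmdeg a)).
pose h' (g : bmultinom n b) : option (bmultinom n b) := insub (mnm_add be g).
rewrite [RHS](reindex_omap h h') /=; last first.
  move=> g /eqP gE; rewrite /h'; case: insubP => [u _ uE|]/=.
    by congr Some; apply/val_inj; rewrite /= uE addmC addmK.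
  by rewrite mdegD gE bek subnKC// mb.
apply: eq_big => [a|a]; last first.
  by move=> /andP[am bea]; rewrite addmC submK.
apply/andP/andP => [[/eqP am bea]|[/eqP am /eqP]].
  have E : mnm_add be (mnm_sub a be) = a by rewrite addmC submK.
  have D : mdeg a = (mdeg be + mdeg (mnm_sub a be))%N by rewrite -mdegD E.
  by rewrite -bek -am D addKn eqxx /h' /= E valK.
rewrite /h' /=; case: insubP => [u _ uE [ua]|//].
have E : mnm_add be (mnm_sub a be) = a by rewrite -[RHS](congr1 (@bmnm _ _) ua).
by rewrite -E mdegD am bek subnKC// eqxx; split=> //; exact: lem_addr.
Qed.

(** The coefficient of [mono z g * mono w be] in the polynomial with
    coefficients [a] evaluated at [z + w]. *)
Definition taylor_coef n (a : multinom n -> C) (be g : multinom n) : C :=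
  a (mnm_add be g) * (mnm_bin (mnm_add be g) be)%:R.

(** The polynomial on the left is the component of degree [k] in [w] of the
    given one at [z + w].  Cauchy's estimate extracts it from the values at
    [z + dl u w], where [u] runs over the roots of unity of order [m + 1]; these
    points lie in [1 + dl] times the closed unit polydisc. *)
Lemma taylor_part_bound n m k b (a : multinom n -> C) (M dl : R) :
  0 < dl -> (k <= m)%N -> (m < b)%N ->
  (forall z, (forall j, normc (z j) <= 1) -> normc (hpoly b m a z) <= M) ->
  forall z w, (forall j, normc (z j) <= 1) -> (forall j, normc (w j) <= 1) ->
  normc (hpoly b k (fun be => hpoly b (m - k) (taylor_coef a be) z) w)
    <= dl ^- k * (1 + dl) ^+ m * M.
Proof.
move=> dl0 km mb aM z w z1 w1.
have [u uN] := prim_root_exists R (ltn0Sn m).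
have u1 : normc u = 1 by apply: normc_root (ltn0Sn m) (prim_expr_order uN).
set X := hpoly _ _ _ _.
pose D : C := (dl%:C)%C.
have normD : normc D = dl by rewrite normc_real// ltW.
pose W (s : 'I_m.+1) := \sum_(al : bmultinom n b | mdeg al == m)
    a al * mono (fun j => z j + (D * u ^+ s) * w j) al.
have key : \sum_(s < m.+1) conjc u ^+ (k * s) * W s = (m.+1)%:R * D ^+ k * X.
  rewrite /W; under eq_bigr do rewrite mulr_sumr.
  rewrite exchange_big /= /X /hpoly mulr_sumr.
  pose term (al be : multinom n) :=
    a al * (mnm_bin al be)%:R * mono z (mnm_sub al be) * mono w be.
  rewrite (eq_bigr (fun al : bmultinom n b =>
      \sum_(be : bmultinom n b | (mdeg be == k) && lem be al)
        (m.+1)%:R * D ^+ k * term al be)); last first.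
    move=> al /eqP alm.
    transitivity (\sum_(be : bmultinom n b | lem be al)
        term al be * D ^+ mdeg be *
        \sum_(s < m.+1) (u ^+ mdeg be * conjc u ^+ k) ^+ s).
      rewrite [RHS](eq_bigr (fun be : bmultinom n b => \sum_(s < m.+1)
          term al be * D ^+ mdeg be * (u ^+ mdeg be * conjc u ^+ k) ^+ s));
        last by move=> be _; rewrite mulr_sumr.
      rewrite exchange_big /=; apply: eq_bigr => s _.
      rewrite (mono_binomial _ _ (_ : mdeg al < b)%N) ?alm// !mulr_sumr.
      apply: eq_bigr => be _; rewrite mono_scale !exprMn -!exprM.
      by rewrite [(s * _)%N]mulnC /term; ring.
    rewrite [RHS]big_mkcondl /=; apply: eq_bigr => be beal.
    have bem : (mdeg be <= m)%N.
      by rewrite -alm !mdegE; apply: leq_sum => j _; move/mnm_lepP: beal; exact.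
    rewrite sum_root_powers//.
    case: eqVneq => [->|]; last by rewrite muln0 mulr0.
    by rewrite muln1; ring.
  rewrite (exchange_big_dep (fun be : bmultinom n b => mdeg be == k)) /=;
    last by move=> ? ? _ /andP[].
  apply: eq_bigr => be /eqP bek.
  rewrite (eq_bigl (fun al : bmultinom n b => (mdeg al == m) && lem be al));
    last by move=> al; rewrite bek eqxx.
  rewrite (sum_mnm_above (fun al => (m.+1)%:R * D ^+ k * term al be) bek km mb).
  rewrite mulr_suml mulr_sumr; apply: eq_bigr => g _.
  by rewrite /term /taylor_coef [X in mnm_sub X _]addmC addmK; ring.
have WM s : normc (W s) <= (1 + dl) ^+ m * M.
  pose D1 : C := ((1 + dl)%:C)%C.
  have d1 : 0 < 1 + dl by rewrite addr_gt0.
  have D1N0 : D1 != 0.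
    rewrite /D1 -(rmorph0 (real_complex R)).
    by rewrite (inj_eq (@fmorph_inj _ _ _)) gt_eqF.
  have normD1 : normc D1 = 1 + dl by rewrite normc_real// ltW.
  pose v j := D1^-1 * (z j + D * u ^+ s * w j).
  have -> : W s = D1 ^+ m * hpoly b m a v.
    rewrite /W /hpoly mulr_sumr; apply: eq_bigr => al /eqP alm.
    rewrite mulrCA -[in D1 ^+ m]alm -mono_scale; congr (_ * _).
    apply: eq_bigr => j _.
    by rewrite /v mulrA divff// mul1r.
  rewrite normcM normcX normD1 ler_wpM2l ?exprn_ge0 ?(ltW d1)//; apply: aM => j.
  rewrite /v normcM normcV normD1 mulrC ler_pdivrMr// mul1r.
  apply: le_trans (le_normcD _ _) _; rewrite lerD// !normcM normcX u1 normD.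
  by rewrite expr1n mulr1 ler_piMr// ltW.
have m1 : (0 : R) < m.+1%:R by rewrite ltr0n.
rewrite -mulrA mulrC ler_pdivlMr ?exprn_gt0// -(ler_pM2l m1).
have -> : m.+1%:R * (normc X * dl ^+ k) =
    normc (\sum_(s < m.+1) conjc u ^+ (k * s) * W s).
  by rewrite key !normcM normc_nat normcX normD mulrAC mulrA.
apply: le_trans (normc_sum _ _ _) _.
rewrite mulr_natl -[m.+1 in leRHS](card_ord m.+1) -sumr_const.
apply: ler_sum => s _.
by rewrite normcM normcX normc_conj u1 expr1n mul1r.
Qed.

End Taylor.

(** * Splitting multi-indices *)

Lemma exists_submnm n (a : multinom n) d : (d <= mdeg a)%N ->
  exists2 g, lem g a & mdeg g = d.
Proof.
elim: d => [|d IH] da.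
  by exists mnm0; [apply/mnm_lepP => j; rewrite mnm0E|rewrite mdeg0].
have [g /mnm_lepP ga gd] := IH (ltnW da).
have [j gaj] : exists j, (g j < a j)%N.
  apply/existsP; apply: contraTT da => /existsPn ag.
  rewrite -leqNgt -gd !mdegE; apply: leq_sum => j _.
  by rewrite leqNgt ag.
exists (mnm_add g (mnm1 j)); last by rewrite mdegD mdeg1 gd addn1.
apply/mnm_lepP => i; rewrite mnmDE mnm1E.
by case: eqVneq => [<-|_]; rewrite ?addn1 ?addn0.
Qed.

Lemma exists_split n l (k : nat -> nat) (a : multinom n) :
  mdeg a = (\sum_(t < l) k t)%N ->
  exists B : nat -> multinom n,
    a = \big[@mnm_add n/@mnm0 n]_(t < l) B t /\
    forall t, (t < l)%N -> mdeg (B t) = k t /\ lem (B t) a.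
Proof.
elim: l a => [|l IH] a.
  rewrite big_ord0 => /eqP; rewrite mdeg_eq0 => /eqP ->.
  by exists (fun _ => mnm0); rewrite big_ord0.
rewrite big_ord_recr /= => am.
have [|g ga gd] := @exists_submnm n a (k l); first by rewrite am leq_addl.
have E : a = mnm_add (mnm_sub a g) g by rewrite submK.
have [|B [aB Bk]] := IH (mnm_sub a g).
  by apply/eqP; rewrite -(eqn_add2r (k l)) -am -gd -mdegD -E.
exists (fun t => if t == l then g else B t); split.
  rewrite big_ord_recr /= eqxx {1}E aB; congr mnm_add.
  by apply: eq_bigr => t _; rewrite ltn_eqF.
move=> t; rewrite ltnS leq_eqVlt => /orP[/eqP ->|tl]; first by rewrite eqxx.
rewrite ltn_eqF//; have [-> Ba] := Bk t tl; split=> //.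
by apply: lepm_trans Ba (lem_subr _ _).
Qed.

(** * Propagation of Bohnenblust-Hille constants *)

Section BohnenblustHille.
Variable R : realType.
Local Notation C := R[i].
Implicit Types n m d k N : nat.

(** The Bohnenblust-Hille inequality with constant [D], for families of
    coefficients.  The norm of the polynomial enters through any upper bound [M]
    on the closed polydisc, which contains the vectors of roots of unity. *)
Definition coef_BH m (D : R) := forall n b (a : multinom n -> C) (M : R),
  (m < b)%N ->
  (forall z, (forall j, normc (z j) <= 1) -> normc (hpoly b m a z) <= M) ->
  \sum_(al : bmultinom n b | mdeg al == m)
     normc (a al) `^ ((2 * m)%:R / m.+1%:R)
  <= (D * M) `^ ((2 * m)%:R / m.+1%:R).

Lemma normc_root_point n N (w : C) (t : {ffun 'I_n -> 'I_N}) j : normc w = 1 ->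
  normc (root_point w t j) <= 1.
Proof. by move=> w1; rewrite /root_point normcX w1 expr1n. Qed.

Lemma mnm_bin_gt0 n (be g : multinom n) : (0 < mnm_bin (mnm_add be g) be)%N.
Proof. by rewrite prodn_gt0// => j; rewrite mnmDE bin_gt0 leq_addr. Qed.

(** The factor that one block of degree [k] contributes to
    [block_interpolation].  Enlarging the inner sum to all [al] above [be] turns
    it into the L^2 norm of a Taylor coefficient, to which [hypercontractive]
    applies; after exchanging the sum over [be] with the average over the roots
    of unity, the inequality in degree [k] is used at each point. *)
Lemma block_factor n m k b (a : multinom n -> C) (M D E dl : R)
    (pi : bmultinom n b -> bmultinom n b) :
  (0 < k)%N -> (k <= m)%N -> (m < b)%N -> 0 < dl -> 0 <= D -> coef_BH k D ->
  (forall z, (forall j, normc (z j) <= 1) -> normc (hpoly b m a z) <= M) ->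
  D * (dl ^- k * (1 + dl) ^+ m * M) <= E ->
  (forall al : bmultinom n b,
     mdeg al == m -> mdeg (pi al) = k /\ lem (pi al) al) ->
  \sum_be (\sum_(al : bmultinom n b | (mdeg al == m) && (pi al == be))
            normc (a al) ^+ 2) `^ (k%:R / k.+1%:R)
  <= 4 `^ ((m - k)%:R / k.+1%:R) * E `^ ((2 * k)%:R / k.+1%:R).
Proof.
move=> k0 km mb dl0 D0 BHk aM DE pik.
have M0 := hpoly_bound_ge0 aM.
have M'0 : 0 <= dl ^- k * (1 + dl) ^+ m * M.
  by rewrite !mulr_ge0 ?invr_ge0 ?exprn_ge0 ?addr_ge0 ?(ltW dl0).
have kk : (k%:R / k.+1%:R : R) != 0.
  by rewrite mulf_neq0 ?invr_neq0 ?pnatr_eq0 -?lt0n.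
have kk0 : 0 <= (k%:R / k.+1%:R : R) by rewrite divr_ge0.
have N0 : (0 < b + b)%N by rewrite addn_gt0 (leq_trans _ mb).
have [w wN] := prim_root_exists R N0.
have w1 : normc w = 1 by apply: normc_root N0 (prim_expr_order wN).
pose S (be : bmultinom n b) := \sum_(g : bmultinom n b | mdeg g == (m - k)%N)
  normc (taylor_coef a be g) ^+ 2.
apply: (@le_trans _ _ (\sum_(be : bmultinom n b | mdeg be == k)
    S be `^ (k%:R / k.+1%:R))).
  rewrite [leLHS](bigID (fun be : bmultinom n b => mdeg be == k)) /=.
  rewrite [X in _ + X]big1 ?addr0; last first.
    move=> be bek; rewrite big_pred0 ?powR0// => al.
    by apply/negP => /andP[/pik[+ _] /eqP pib]; rewrite pib => /eqP; apply/negP.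
  apply: ler_sum => be /eqP bek.
  rewrite ge0_ler_powR ?nnegrE//; try by apply: sumr_ge0 => *; exact: sqr_ge0.
  apply: (@le_trans _ _ (\sum_(al : bmultinom n b | (mdeg al == m) && lem be al)
     normc (a al) ^+ 2)).
    rewrite [leRHS]big_mkcond [leLHS]big_mkcond; apply: ler_sum => al _.
    case: ifP => [/andP[alm /eqP <-]|_].
      by rewrite alm; have [_ ->] := pik _ alm.
    by case: ifP => // _; exact: sqr_ge0.
  rewrite (sum_mnm_above (fun al => normc (a al) ^+ 2) bek km mb).
  apply: ler_sum => g _; rewrite /taylor_coef normcM exprMn ler_peMr ?sqr_ge0//.
  by rewrite normc_nat -natrX ler1n expn_gt0 mnm_bin_gt0.
set V : R := ((b + b) ^ n)%:R.
have V0 : 0 < V by rewrite ltr0n expn_gt0 N0.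
apply: (@le_trans _ _ (\sum_(be : bmultinom n b | mdeg be == k)
  4 `^ ((m - k)%:R / k.+1%:R) * (V^-1 * \sum_(t : {ffun 'I_n -> 'I_(b + b)})
    normc (hpoly b (m - k) (taylor_coef a be) (root_point w t))
      `^ ((2 * k)%:R / k.+1%:R)))).
  by apply: ler_sum => be _; exact: hypercontractive.
rewrite -mulr_sumr ler_wpM2l ?powR_ge0// -mulr_sumr exchange_big /=.
rewrite ler_pdivrMl// /V (mulr_natl (E `^ _)).
have <- : #|{ffun 'I_n -> 'I_(b + b)}| = ((b + b) ^ n)%N.
  by rewrite card_ffun !card_ord.
rewrite -sumr_const [leRHS](eq_bigl xpredT)//; apply: ler_sum => t _.
have kb := leq_ltn_trans km mb.
have := @BHk n b
  (fun be => hpoly b (m - k) (taylor_coef a be) (root_point w t)) _ kb.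
move=> /(_ (dl ^- k * (1 + dl) ^+ m * M) _)/le_trans; apply.
  move=> z z1.
  apply: (@taylor_part_bound _ n m k b a M dl dl0 km mb aM) => // j.
  exact: normc_root_point.
rewrite ge0_ler_powR ?nnegrE ?divr_ge0//; first by rewrite mulr_ge0.
by apply: le_trans DE; rewrite mulr_ge0.
Qed.

(** The factors [2^((m - k_t)/m)] of the [l] blocks multiply to [2^(l-1)],
    because the [k_t] add up to [m]; the other factors enter with exponents
    [k_t/m], of sum 1, so that the common bound [K] enters only once. *)
Lemma coef_BH_blocks l (k : nat -> nat) (D : nat -> R) (dl K : R)
    (m := (\sum_(t < l) k t)%N) :
  (0 < l)%N -> 0 < dl -> (forall t, (t < l)%N -> (0 < k t)%N) ->
  (forall t, (t < l)%N -> 0 <= D t /\ coef_BH (k t) (D t)) ->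
  (forall t, (t < l)%N -> D t * dl ^- k t <= K) ->
  coef_BH m (2 ^+ l.-1 * K * (1 + dl) ^+ m).
Proof.
move=> l0 dl0 k0 BHk DK n b a M mb aM.
have M0 := hpoly_bound_ge0 aM.
have km t : (t < l)%N -> (k t <= m)%N.
  by move=> tl; rewrite /m (bigD1 (Ordinal tl))//= leq_addr.
have m0 : (0 < m)%N := leq_trans (k0 _ l0) (km _ l0).
have /boolp.choice[B HB] : forall al : multinom n, exists B : nat -> multinom n,
    mdeg al = m -> al = \big[@mnm_add n/@mnm0 n]_(t < l) B t /\
    forall t, (t < l)%N -> mdeg (B t) = k t /\ lem (B t) al.
  move=> al; have [/exists_split[B HB]|ne] := eqVneq (mdeg al) m.
    by exists B.
  by exists (fun _ => mnm0) => e; rewrite e eqxx in ne.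
pose pi (t : 'I_l) (al : bmultinom n b) : bmultinom n b := insubd al (B al t).
have piE t (al : bmultinom n b) : mdeg al = m -> bmnm (pi t al) = B al t.
  move=> alm; have [_ /(_ t (ltn_ord t))[Bk _]] := HB _ alm.
  by rewrite /pi val_insubd Bk (leq_ltn_trans (km _ _) mb).
set E := K * (1 + dl) ^+ m * M.
have K0 : 0 <= K.
  apply: le_trans (DK 0%N l0).
  rewrite mulr_ge0 ?invr_ge0 ?exprn_ge0 ?(ltW dl0)//.
  by case: (BHk 0%N l0).
have E0 : 0 <= E by rewrite !mulr_ge0 ?exprn_ge0 ?addr_ge0 ?(ltW dl0).
have := @block_interpolation R _ _ _ (fun al : bmultinom n b => mdeg al == m) pi
  (fun t : 'I_l => k t) (fun al => normc (a al)) m0.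
rewrite -/m => /(_ _ _ _)/le_trans; apply.
- by move=> t; exact: k0.
- move=> x y /eqP xm /eqP ym xy; apply/val_inj => /=.
  have [-> _] := HB _ xm; have [-> _] := HB _ ym.
  by apply: eq_bigr => t _; rewrite -!piE// xy.
- by move=> al; exact: normc_ge0.
have m1 : (0 : R) < m.+1%:R by rewrite ltr0n.
apply: (@le_trans _ _ (\prod_(t < l) (4 `^ ((m - k t)%:R / m.+1%:R) *
    (E `^ (2%:R / m.+1%:R)) ^+ k t))).
  apply: ler_prod => t _; rewrite powR_ge0 /=.
  have tl := ltn_ord t; have [D0 Bt] := BHk _ tl.
  have k1 : ((k t).+1%:R : R) != 0 by rewrite pnatr_eq0.
  apply: (@le_trans _ _ ((4 `^ ((m - k t)%:R / (k t).+1%:R) *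
     E `^ ((2 * k t)%:R / (k t).+1%:R)) `^ ((k t).+1%:R / m.+1%:R))).
    rewrite ge0_ler_powR ?nnegrE ?divr_ge0//.
    - by apply: sumr_ge0 => *; exact: powR_ge0.
    - by rewrite mulr_ge0 ?powR_ge0.
    apply: (@block_factor n m (k t) b a M (D t) E dl) => //.
    - exact: k0.
    - exact: km.
    - rewrite /E !mulrA ler_wpM2r// ler_wpM2r ?exprn_ge0 ?addr_ge0 ?(ltW dl0)//.
      exact: DK.
    - by move=> al /eqP alm; rewrite piE//; have [_ /(_ t tl)] := HB _ alm.
  rewrite powRM ?powR_ge0// -!powRrM -powR_mulrn ?powR_ge0// -powRrM.
  have mk : (m.+1%:R : R) != 0 by rewrite pnatr_eq0.
  rewrite !mulrA !divfK// natrM [2%:R * _]mulrC.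
  by rewrite [_ / _ * (k t)%:R]mulrAC [2%:R * _]mulrC.
rewrite big_split /= -expr_sum -/m -powR_sum//.
rewrite -powR_mulrn ?powR_ge0// -powRrM mulrAC -natrM.
have -> : \sum_(t < l) (m - k t)%:R / m.+1%:R =
    (l.-1)%:R * ((2 * m)%:R / m.+1%:R) / 2%:R :> R.
  rewrite -mulr_suml -natr_sum.
  have -> : (\sum_(t < l) (m - k t) = l.-1 * m)%N.
    apply/eqP; rewrite -(eqn_add2r m) {2}/m -big_split /=.
    rewrite (eq_bigr (fun=> m)); last by move=> t _; rewrite subnK// km.
    by rewrite sum_nat_const card_ord -mulSnr prednK.
  rewrite !natrM; field.
  by rewrite gt_eqF.
have -> : (4 : R) = 2 `^ 2 by rewrite powR_mulrn// -natrX.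
rewrite -powRrM [2 * (_ / 2)]mulrC divfK// powRrM powR_mulrn//.
rewrite -powRM ?exprn_ge0//.
by rewrite /E !mulrA.
Qed.

Lemma coef_BH_le m (D D' : R) :
  0 <= D -> D <= D' -> coef_BH m D -> coef_BH m D'.
Proof.
move=> D0 DD' BHD n b a M mb aM; apply: le_trans (BHD n b a M mb aM) _.
have M0 := hpoly_bound_ge0 aM.
have D'0 := le_trans D0 DD'.
by rewrite ge0_ler_powR ?nnegrE ?divr_ge0 ?mulr_ge0 ?ler_wpM2r.
Qed.

(** A linear form attains the sum of the moduli of its coefficients where the
    arguments of the coordinates cancel those of the coefficients. *)
Lemma coef_BH1 : coef_BH 1 (1 : R).
Proof.
move=> n b a M b1 aM.
have -> : (2 * 1)%:R / 2%:R = 1 :> R by rewrite muln1 divff.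
pose z (j : 'I_n) : C := conjc (a (mnm1 j)) / ((normc (a (mnm1 j)))%:C)%C.
have M0 := hpoly_bound_ge0 aM.
rewrite mul1r powRr1//; under eq_bigr do rewrite powRr1 ?normc_ge0//.
have := aM z; rewrite (_ : hpoly b 1 a z =
    ((\sum_(al : bmultinom n b | mdeg al == 1) normc (a al))%:C)%C).
  rewrite normc_real; last by apply: sumr_ge0 => *; exact: normc_ge0.
  apply => j; rewrite /z normcM normcV normc_conj normc_real ?normc_ge0//.
  by have [->|?] := eqVneq (normc (a (mnm1 j))) 0; rewrite ?mul0r ?divff.
rewrite rmorph_sum /=; apply: eq_bigr => al /mdeg1P[j /eqP ->].
have -> : mono z (mnm1 j) = z j.
  rewrite /mono (bigD1 j)//= mnm1E eqxx big1 ?mulr1// => i ij.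
  by rewrite mnm1E eq_sym (negbTE ij).
rewrite /z mulrA -sqr_normcC rmorphXn /=.
have [->|?] := eqVneq ((normc (a (mnm1 j)))%:C)%C 0.
  by rewrite expr0n mul0r.
by rewrite expr2 mulfK.
Qed.

(** [coef_BH_blocks] with [m] blocks of degree 1 and [dl = 1]. *)
Lemma coef_BH_exponential m : (0 < m)%N -> coef_BH m (4 ^+ m : R).
Proof.
move=> m0; have := @coef_BH_blocks m (fun=> 1%N) (fun=> 1) 1 1 m0 ltr01.
rewrite sum1_card card_ord => /(_ _ _ _)/coef_BH_le; apply=> [||//|t _|t _].
- by rewrite mulr1 mulr_ge0 ?exprn_ge0 ?addr_ge0.
- have -> : (4 : R) = 2 * 2 by rewrite -natrM.
  by rewrite mulr1 exprMn ler_wpM2r ?exprn_ge0// ler_weXn2l ?ler1n// leq_pred.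
- by split=> //; exact: coef_BH1.
- by rewrite expr1 invr1 mulr1.
Qed.

(** [coef_BH_blocks] with [m.-1 %/ k] blocks of degree [k] and one more block,
    of degree between 1 and [k].  The constants [4 ^ ks t] of
    [coef_BH_exponential] stay bounded because the degrees [ks t] do. *)
Lemma coef_BH_subexponential (eps : R) : 0 < eps ->
  exists2 K : R, 1 <= K & forall m, (0 < m)%N -> coef_BH m (K * (1 + eps) ^+ m).
Proof.
move=> eps0.
(* The factor [(1 + dl) ^+ m] occurs twice, and
   [(1 + dl) ^+ 2 <= 1 + 3 * dl] because [dl <= 1]. *)
pose dl : R := Num.min 1 (eps / 3).
have dl0 : 0 < dl by rewrite lt_min ltr01 divr_gt0.
have dl1 : dl <= 1 by rewrite ge_min lexx.
have dleps : (1 + dl) ^+ 2 <= 1 + eps.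
  have : dl <= eps / 3 by rewrite ge_min lexx orbT.
  have : 0 <= dl * (1 - dl) by rewrite mulr_ge0 ?subr_ge0 ?(ltW dl0).
  rewrite expr2; lra.
have [k k0 dlk] : exists2 k, (0 < k)%N & 2 <= (1 + dl) ^+ k.
  exists (Num.bound dl^-1) => //.
  apply: le_trans (bernoulli_inequality _ _); last first.
    by rewrite (le_trans _ (ltW dl0)).
  rewrite -[2]/(1 + 1) lerD2l -ler_pdivrMr// mul1r ltW// archi_boundP//.
  by rewrite invr_ge0 ltW.
have dl4 : 1 <= 4 / dl by rewrite ler_pdivlMr// mul1r (le_trans dl1)// ler1n.
exists ((4 / dl) ^+ k); first by rewrite exprn_ege1.
move=> m m0; pose q := (m.-1 %/ k)%N.
pose ks t := if t == q then (m - k * q)%N else k.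
have qm : (k * q < m)%N.
  by rewrite -[ltnRHS](prednK m0) ltnS mulnC leq_divM.
have ksk t : (0 < ks t <= k)%N.
  rewrite /ks; case: ifP => _; rewrite ?k0 ?leqnn// subn_gt0 qm /=.
  rewrite leq_subLR -mulnSr -[m in leqLHS](prednK m0) mulnC.
  by rewrite ltn_ceil.
have ksm : (\sum_(t < q.+1) ks t = m)%N.
  rewrite big_ord_recr /= {2}/ks eqxx (eq_bigr (fun=> k)).
    by rewrite sum_nat_const card_ord mulnC subnKC// ltnW.
  by move=> t _; rewrite /ks ltn_eqF.
have := @coef_BH_blocks q.+1 ks (fun t => 4 ^+ ks t) dl ((4 / dl) ^+ k)
  (ltn0Sn q) dl0.
rewrite ksm => /(_ _ _ _)/coef_BH_le; apply=> [||t _|t _|t _].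
- by rewrite !mulr_ge0 ?exprn_ge0 ?divr_ge0 ?addr_ge0 ?invr_ge0 ?(ltW dl0).
- have le1 : 2 ^+ q <= (1 + dl) ^+ m.
    apply: (@le_trans _ _ (((1 + dl) ^+ k) ^+ q)).
      by rewrite lerXn2r ?nnegrE ?exprn_ge0 ?addr_ge0 ?(ltW dl0).
    by rewrite -exprM ler_weXn2l ?lerDl ?(ltW dl0)// ltnW.
  rewrite /= mulrAC mulrC ler_wpM2l ?exprn_ge0 ?divr_ge0 ?(ltW dl0)//.
  apply: (@le_trans _ _ ((1 + dl) ^+ m * (1 + dl) ^+ m)).
    by rewrite ler_wpM2r ?exprn_ge0 ?addr_ge0 ?(ltW dl0).
  by rewrite -exprMn -expr2 lerXn2r ?nnegrE ?sqr_ge0 ?addr_ge0 ?(ltW eps0).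
- by case/andP: (ksk t).
- by split; [exact: exprn_ge0|apply: coef_BH_exponential; case/andP: (ksk t)].
- by rewrite -expr_div_n ler_weXn2l//; case/andP: (ksk t).
Qed.

Lemma meval_hpoly n m (P : mpoly n C) (z : 'I_n -> C) : P \is ishomog1 m mdeg ->
  meval z P = hpoly m.+1 m (fun al => mcoeff al P) z.
Proof.
move=> Ph; have Pm : {in msupp P, forall al, mdeg al = m} by exact/dhomogP.
rewrite {1}(@mpolywE _ _ m.+1 P); last first.
  rewrite msizeE; apply/bigmax_leqP_seq => al alP _.
  by rewrite Pm.
rewrite raddf_sum /= (bigID (fun al : bmultinom n m.+1 => mdeg al == m)) /=.
rewrite [X in _ + X]big1 ?addr0; last first.
  move=> al alm; rewrite memN_msupp_eq0 ?scale0r ?raddf0//.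
  by apply: contra alm => /Pm ->.
by apply: eq_bigr => al _; rewrite mevalZ mevalX.
Qed.

(** [sup_norm] is taken over the open polydisc, so a point [z] of the closed one
    is reached through [r z] with [r < 1], where the value is multiplied by
    [r ^+ m]. *)
Lemma meval_le_sup_norm n m (P : mpoly n C) (z : 'I_n -> C) :
  P \is ishomog1 m mdeg ->
  (forall j, normc (z j) <= 1) -> normc (meval z P) <= sup_norm P.
Proof.
move=> Ph z1; set x : R := normc _; set s : R := sup_norm P.
have rx (r : R) : 0 < r < 1 -> r ^+ m * x <= s.
  move=> /andP[r0 r1]; pose r' : C := (r%:C)%C.
  have normr' : normc r' = r by rewrite normc_real// ltW.
  have -> : r ^+ m * x = normc (meval (fun j => r' * z j) P).
    by rewrite /x !(meval_hpoly _ Ph) hpoly_scale normcM normcX normr'.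
  apply: ub_le_sup; first by case: (has_sup_polydisc P).
  exists (fun j => r' * z j) => // j /=; rewrite normcM normr'.
  by apply: le_lt_trans r1; rewrite ler_piMr// ltW.
have x0 : 0 <= x by exact: normc_ge0.
rewrite leNgt; apply/negP => sx.
have s0 : 0 <= s.
  apply: le_trans (rx 2^-1 _); first by rewrite mulr_ge0 ?exprn_ge0 ?invr_ge0.
  by rewrite invr_gt0 ltr0n invf_lt1 ?ltr1n.
have xgt0 : 0 < x by exact: le_lt_trans sx.
(* With [r = 1 - h], Bernoulli's inequality gives [r ^+ m * x >= x - m h x],
   and this [h] makes [m h x] at most half of [x - s]. *)
pose h : R := (x - s) / (2 * m.+1%:R * x).
have m1 : (1 : R) <= m.+1%:R by rewrite ler1n.
have h0 : 0 < h by rewrite divr_gt0 ?subr_gt0// !mulr_gt0// ltr0n.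
have hx : m.+1%:R * h * x = (x - s) / 2.
  by rewrite /h; field; rewrite lt0r_neq0//= -natr1 natr1 pnatr_eq0.
have h1 : h < 1.
  have : h * x <= m.+1%:R * h * x.
    rewrite -mulrA ler_peMl//.
    by rewrite mulr_ge0// ltW.
  rewrite hx -(ltr_pM2r xgt0) => hh.
  apply: le_lt_trans hh _; rewrite mul1r; lra.
have := rx (1 - h); rewrite subr_gt0 h1 gtrBl h0 => /(_ isT).
have : (1 + m%:R * - h) * x <= (1 - h) ^+ m * x.
  by rewrite ler_wpM2r// bernoulli_inequality// lerN2 ltW.
have : m%:R * h * x <= m.+1%:R * h * x.
  by rewrite -natr1 !mulrDl lerDl mul1r mulr_ge0// ltW.
rewrite hx; lra.
Qed.

Lemma coef_BH_pol_bound m (D : R) :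
  (0 < m)%N -> 0 <= D -> coef_BH m D -> BH_pol_bound m D.
Proof.
move=> m0 D0 BHD n _ P Ph; rewrite /coef_norm.
set p : R := _ / _.
have p0 : 0 < p by rewrite divr_gt0 ?ltr0n// muln_gt0.
have H z : (forall j, normc (z j) <= 1) ->
    normc (hpoly m.+1 m (fun al => mcoeff al P) z) <= sup_norm P.
  by move=> z1; rewrite -meval_hpoly// (meval_le_sup_norm Ph).
have s0 : 0 <= sup_norm P.
  exact: hpoly_bound_ge0 H.
apply: (@le_trans _ _ (((D * sup_norm P) `^ p) `^ p^-1)).
  rewrite ge0_ler_powR ?nnegrE ?invr_ge0 ?(ltW p0) ?powR_ge0//.
    by apply: sumr_ge0 => *; exact: powR_ge0.
  exact: (@BHD n _ (fun al => mcoeff al P)) (ltnSn m) H.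
by rewrite -powRrM divff ?gt_eqF// powRr1// mulr_ge0.
Qed.

End BohnenblustHille.

Theorem corollary5p3 (R : realType) (eps : R) :
  0 < eps ->
  exists kappa : R, 0 < kappa /\
    forall m : nat, (1 <= m)%N ->
      (BH_pol R m <= (kappa * (1 + eps) ^+ m)%:E)%E.
Proof.
move=> eps0; have [K K1 BHK] := coef_BH_subexponential eps0.
exists K; split=> [|m m1]; first exact: lt_le_trans K1.
have D1 : 1 <= K * (1 + eps) ^+ m.
  by rewrite mulr_ege1// exprn_ege1// lerDl ltW.
apply: ereal_inf_lbound; exists (K * (1 + eps) ^+ m) => //; split=> //.
apply: coef_BH_pol_bound (BHK _ m1) => //.
exact: le_trans D1.
Qed.
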